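(* Let $P:\mathbb{R}\to\mathbb{R}$ be bounded, differentiable and integrable, not identically zero, such that its Fourier transform $\hat P$ is real-valued, and suppose $P(0)=0$. Let $r$ be a real number with $$ r>\frac{8^3\,\|P'\|_\infty}{\pi\,\|P\|_\infty}. $$ Then both $$ \frac{4}{\sqrt{2\pi}}\int_{-r}^{r}(\hat P)_+(\omega)\,d\omega\ \ge\ \|P\|_\infty \qquad\text{and}\qquad \frac{4}{\sqrt{2\pi}}\int_{-r}^{r}(\hat P)_-(\omega)\,d\omega\ \ge\ \|P\|_\infty . $$
   Context: The Fourier transform of an integrable $f:\mathbb{R}\to\mathbb{C}$ is $\hat f(\omega)=\frac{1}{\sqrt{2\pi}}\int_{\mathbb{R}}f(x)e^{-i\omega x}\,dx$. For a real number $x$, $x_+=\max\{x,0\}$ and $x_-=\max\{-x,0\}$; $(\hat P)_\pm(\omega)=(\hat P(\omega))_\pm$. $\|\cdot\|_\infty$ is the supremum norm on $\mathbb{R}$; if $\|P'\|_\infty=\infty$, no real $r$ satisfies the hypothesis and the statement is vacuous. *)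

(* Defs.v *)
From HB Require Import structures.
From mathcomp Require Import all_boot all_order all_algebra.
From mathcomp Require Import all_classical all_reals all_analysis.
From mathcomp Require Export complex.

Set Implicit Arguments.
Unset Strict Implicit.
Unset Printing Implicit Defensive.

Import Order.TTheory GRing.Theory Num.Theory.
Import numFieldNormedType.Exports.

Local Open Scope classical_set_scope.
Local Open Scope ring_scope.
Local Open Scope complex_scope.

(* Extended-real valued, so that it is +oo for unbounded functions. *)
Definition supnorm (R : realType) (f : R -> R) : \bar R :=
  ereal_sup (range (fun x => `|f x|%:E)).

(* e^{it} for real t. *)
Definition cexpi (R : realType) (t : R) : R[i] := cos t +i* sin t.

(* Meaningful when the real and imaginary parts of f are integrable. *)
Definition cintegral (R : realType) (f : R -> R[i]) : R[i] :=
  (\int[lebesgue_measure]_x complex.Re (f x)) +i*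
  (\int[lebesgue_measure]_x complex.Im (f x)).

Definition fourier (R : realType) (f : R -> R[i]) (w : R) : R[i] :=
  ((Num.sqrt (2 * pi))^-1)%:C * cintegral (fun x => f x * cexpi (- (w * x))).

Definition fourierR (R : realType) (P : R -> R) : R -> R[i] :=
  fourier (fun x => (P x)%:C).

(* Main.v *)
Require Import Defs.
From mathcomp Require Import all_boot all_order all_algebra.
From mathcomp Require Import all_classical all_reals all_analysis.
From mathcomp Require Import complex.
From mathcomp Require Import measurable_realfun ring lra.

(** Let [K] be the Fejer kernel whose transform is the triangle supported on
    [[-r, r]]; it is nonnegative with integral [1] and [K y <= 2 / (pi r y^2)].
    Splitting the convolution at distance [d = 64 / (pi r)], the Lipschitz bound
    near the centre and the decay of [K] away from it give
    [|(K * P) x - P x| <= M / 4] with [M] the sup norm of [P].  By Fubini,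
    [K * P] is the inverse transform of the triangle times [Phat], so if [A]
    and [B] are the integrals of the triangle times [Phat^+] and [Phat^-], then
    [sqrt (2 pi) |(K * P) x| <= A + B], while [P 0 = 0] makes [|A - B|] at most
    [sqrt (2 pi) M / 4].  Hence [M <= 2 A / sqrt (2 pi) + M / 2], and the same
    with [B]. *)

Import Order.TTheory GRing.Theory Num.Theory.
Import numFieldNormedType.Exports.

Local Open Scope classical_set_scope.
Local Open Scope ring_scope.

(** * Improper integrals *)

Section FTC.
Context {R : realType}.
Local Notation mu := (@lebesgue_measure R).
Implicit Types (f F : R -> R) (a b x l : R).

Lemma derivable1_continuous f x : derivable f x 1 -> {for x, continuous f}.
Proof. by move=> /derivable1_diffP /differentiable_continuous. Qed.

Lemma integral_is_derive f F a b : a < b -> continuous f ->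
  (forall x, is_derive x 1 F (f x)) ->
  \int[mu]_(x in `[a, b]) f x = F b - F a.
Proof.
move=> ab cf dF; have cF x : {for x, continuous F}.
  exact/derivable1_continuous.
rewrite /Rintegral (@continuous_FTC2 _ f F)//.
- exact: continuous_subspaceT.
- split => [x _||]; first exact: ex_derive.
  + by apply: cvg_at_right_filter; exact: cF.
  + by apply: cvg_at_left_filter; exact: cF.
- by move=> x _; rewrite derive1E; exact: derive_val.
Qed.

(** Since [f] is nonnegative the integral lives in the extended reals, so the limit of [F] at
    infinity yields convergence and value at once. *)
Lemma integraly_is_derive f F a l :
  (forall x, a <= x -> 0 <= f x) ->
  (forall x, a <= x -> {for x, continuous f}) ->
  (forall x, a <= x -> is_derive x 1 F (f x)) ->
  F x @[x --> +oo] --> l ->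
  (\int[mu]_(x in `[a, +oo[) (f x)%:E = (l - F a)%:E)%E.
Proof.
move=> f0 cf dF Fl; rewrite EFinB (ge0_continuous_FTC2y f0 _ Fl)//.
- apply/continuous_within_itvcyP; split=> [x|].
    by rewrite in_itv/= andbT => ax; exact/cf/ltW.
  by apply: cvg_at_right_filter; exact: cf.
- by move=> x ax; have := dF x (ltW ax) => ?; exact: ex_derive.
- apply: cvg_at_right_filter; apply: derivable1_continuous.
  by have := dF a (lexx _) => ?; exact: ex_derive.
- move=> x; rewrite in_itv/= andbT => ax.
  by have := dF x (ltW ax) => ?; rewrite derive1E; exact: derive_val.
Qed.

(** Serves to show that the boundary term at [+oo] of an explicit antiderivative vanishes. *)
Lemma cvgy0_le_inv F (C : R) : (forall x, 0 < x -> `|F x| <= C / x) ->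
  F x @[x --> +oo] --> 0.
Proof.
move=> FC; apply/cvgrPdist_le => e e0; near=> x.
have x0 : 0 < x by near: x; exact: nbhs_pinfty_gt.
rewrite sub0r normrN (le_trans (FC _ x0))// ler_pdivrMr//.
rewrite -ler_pdivrMl; last exact: e0.
by near: x; apply: nbhs_pinfty_ge; rewrite num_real.
Unshelve. all: by end_near. Qed.

Lemma expRN_le_inv (x : R) : 0 < x -> expR (- x) <= x^-1.
Proof.
move=> x0; rewrite expRN lef_pV2 ?posrE ?expR_gt0//.
by rewrite (le_trans _ (expR_ge1Dx x))// ?lerDr.
Qed.

Lemma expRN_le_invX2 (x : R) : 0 < x -> expR (- x) <= 2 / x ^+ 2.
Proof.
move=> x0; rewrite expRN -invf_div lef_pV2 ?posrE ?expR_gt0 ?divr_gt0 ?exprn_gt0//.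
by rewrite (le_trans _ (expR_ge1Dxn 1 (ltW x0)))// ?lerDr.
Qed.

End FTC.

(** * Explicit integrals behind the Fejer kernel *)

Section FejerIntegral.
Context {R : realType}.
Local Notation mu := (@lebesgue_measure R).

Lemma integral_triangle_cos (r y : R) : 0 < r -> y != 0 ->
  \int[mu]_(w in `[0, r]) ((1 - w / r) * cos (w * y)) =
  (1 - cos (r * y)) / (r * y ^+ 2).
Proof.
move=> r0 y0; have rn0 : r != 0 by rewrite gt_eqF.
(* One integration by parts, differentiating the linear factor, gives this antiderivative. *)
have dF (w : R) : is_derive w 1 (fun w => (1 - w / r) * sin (w * y) / y
    - cos (w * y) / (r * y ^+ 2)) ((1 - w / r) * cos (w * y)).
  by apply: is_derive_eq; rewrite /GRing.scale /=; field; rewrite rn0 y0.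
rewrite (integral_is_derive _ _ _ _ r0 _ dF).
  by rewrite !mul0r sin0 cos0; field; rewrite rn0 y0.
move=> w; apply: derivable1_continuous; exact: ex_derive.
Qed.

(** Laplace transform of [1 - cos (r y)] at [t], that is [1 / t - t / (t^2 + r^2)]. *)
Lemma integraly_1Bcos_expR (r t : R) : 0 < r -> 0 < t ->
  (\int[mu]_(y in `[0%R, +oo[) ((1 - cos (r * y)) * expR (- (t * y)))%:E =
   (r ^+ 2 / (t * (t ^+ 2 + r ^+ 2)))%:E)%E.
Proof.
move=> r0 t0; have [rn0 tn0] : r != 0 /\ t != 0 by rewrite !gt_eqF.
have tr0 : t ^+ 2 + r ^+ 2 != 0 by rewrite gt_eqF// addr_gt0// exprn_gt0.
have dF (y : R) : is_derive y 1 (fun y => expR (- (t * y)) *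
    ((t * cos (r * y) - r * sin (r * y)) / (t ^+ 2 + r ^+ 2) - t^-1))
    ((1 - cos (r * y)) * expR (- (t * y))).
  by apply: is_derive_eq; rewrite /GRing.scale /=; field; rewrite tr0 tn0.
rewrite (integraly_is_derive _ _ _ 0 _ _ (fun y _ => dF y)).
- by congr EFin; rewrite !mulr0 oppr0 expR0 cos0 sin0; field; rewrite tn0 tr0.
- by move=> y _; rewrite mulr_ge0 ?expR_ge0// subr_ge0 cos_le1.
- move=> y _; apply: derivable1_continuous; exact: ex_derive.
(* The trigonometric bracket is at most [(t + r) / (t^2 + r^2) + 1 / t] in absolute value, and the
   exponential at most [1 / (t y)]. *)
- apply: (@cvgy0_le_inv _ _ (((t + r) / (t ^+ 2 + r ^+ 2) + t^-1) / t)) => y y0.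
  rewrite normrM ger0_norm ?expR_ge0// -mulrA -invfM mulrC.
  apply: ler_pM => //; rewrite ?expR_ge0//; last first.
    by apply: expRN_le_inv; rewrite mulr_gt0.
  rewrite (le_trans (ler_normB _ _))// (gtr0_norm (_ : 0 < t^-1)) ?invr_gt0// lerD2r.
  rewrite normrM normfV (gtr0_norm (_ : 0 < t ^+ 2 + r ^+ 2)) ?addr_gt0 ?exprn_gt0//.
  rewrite ler_pM2r ?invr_gt0 ?addr_gt0 ?exprn_gt0//.
  rewrite (le_trans (ler_normB _ _))// !normrM (gtr0_norm r0) (gtr0_norm t0).
  by rewrite lerD// ler_piMr ?(ltW r0) ?(ltW t0)// ler_norml ?cos_geN1 ?cos_le1 ?sin_geN1 ?sin_le1.
Qed.

(** Represents [1 / y^2] as a Laplace transform, which replaces the singular denominator of the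
    Fejer integral by an exponential. *)
Lemma integraly_Mexpn (y : R) : 0 < y ->
  (\int[mu]_(t in `[0%R, +oo[) (t * expR (- (t * y)))%:E = (y ^- 2)%:E)%E.
Proof.
move=> y0; have yn0 : y != 0 by rewrite gt_eqF.
have dF (t : R) : is_derive t 1
    (fun t => - ((t / y + (y ^+ 2)^-1) * expR (- (t * y))))
    (t * expR (- (t * y))).
  by apply: is_derive_eq; rewrite /GRing.scale /=; field; rewrite yn0.
rewrite (integraly_is_derive _ _ _ 0 _ _ (fun t _ => dF t)).
- by congr EFin; rewrite !mul0r oppr0 expR0; field; rewrite yn0.
- by move=> t t0; rewrite mulr_ge0// expR_ge0.
- move=> t _; apply: derivable1_continuous; exact: ex_derive.
(* The constant is [3 = 2 + 1]: the term [t / y] is paired with [exp (- u) <= 2 / u^2] and the term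
   [1 / y^2] with [exp (- u) <= 1 / u], where [u = t y]. *)
- apply: (@cvgy0_le_inv _ _ (3 / y ^+ 3)) => t t0.
  have ty0 : 0 < t * y by rewrite mulr_gt0.
  rewrite normrN ger0_norm; last first.
    by rewrite mulr_ge0 ?expR_ge0// addr_ge0// ?divr_ge0 ?invr_ge0 ?exprn_ge0 ?ltW.
  rewrite mulrDl (_ : 3 / _ / t = t / y * (2 / (t * y) ^+ 2) +
      (y ^+ 2)^-1 * (t * y)^-1); last first.
    by field; rewrite yn0 gt_eqF.
  have yt0 : 0 <= t / y by rewrite divr_ge0// ltW.
  by rewrite lerD// ler_wpM2l// ?expRN_le_invX2 ?expRN_le_inv// invr_ge0 sqr_ge0.
Qed.

(** The antiderivative is [r atan (t / r)]. This is the outer integral left once the order of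
    integration has been exchanged. *)
Lemma integraly_lorentz (r : R) : 0 < r ->
  (\int[mu]_(t in `[0%R, +oo[) (r ^+ 2 / (t ^+ 2 + r ^+ 2))%:E =
   (r * (pi / 2))%:E)%E.
Proof.
move=> r0; have rn0 : r != 0 by rewrite gt_eqF.
have tr0 t : t ^+ 2 + r ^+ 2 != 0 by rewrite gt_eqF// ltr_wpDl ?exprn_gt0// sqr_ge0.
have dF (t : R) : is_derive t 1 (fun t => r * atan (t / r)) (r ^+ 2 / (t ^+ 2 + r ^+ 2)).
  apply: is_derive_eq; rewrite /GRing.scale /=; field.
  by rewrite tr0 rn0.
have cD : continuous (fun t : R => t ^+ 2 + r ^+ 2).
  by move=> t; apply: derivable1_continuous; exact: ex_derive.
rewrite (integraly_is_derive _ _ _ (r * (pi / 2)) _ _ (fun t _ => dF t)).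
- by rewrite mul0r atan0 mulr0 subr0.
- by move=> t _; rewrite divr_ge0 ?addr_ge0 ?sqr_ge0.
- move=> t _; apply: cvgM; first exact: cvg_cst.
  by apply: cvgV; [exact: tr0|exact: cD].
- apply: cvgM; first exact: cvg_cst.
  apply: (@cvg_comp _ _ _ (fun t => t / r) atan _ +oo); last exact: cvgy_atan.
  by apply: gt0_cvgMly; [rewrite invr_gt0|exact: cvg_id].
Qed.

End FejerIntegral.

(** * The Fejer kernel *)

Section Kernel.
Context {R : realType}.
Local Notation mu := (@lebesgue_measure R).

(** Trades a domain of integration for an indicator factor, so that Tonelli can be applied to one
    function on the whole plane. *)
Lemma integral_indicM (D : set R) (f : R -> R) :
  (\int[mu]_x (\1_D x * f x)%:E = \int[mu]_(x in D) (f x)%:E)%E.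
Proof.
rewrite [RHS]integral_mkcond; apply: eq_integral => x _.
by rewrite patchE indicE; case: ifP => _; rewrite ?mul1r ?mul0r.
Qed.

Lemma le_integrable_real (f g : R -> R) : measurable_fun setT f ->
  (forall x, `|f x| <= g x) -> mu.-integrable setT (EFin \o g) ->
  mu.-integrable setT (EFin \o f).
Proof.
move=> mf fg; apply: le_integrable => //; first exact/measurable_EFinP.
by move=> x _; rewrite /= lee_fin (le_trans (fg x))// ler_norm.
Qed.

Lemma measurable_Mexp (y : R) :
  measurable_fun setT (fun t : R => t * expR (- (t * y))).
Proof.
apply: continuous_measurable_fun => t; apply: derivable1_continuous.
exact: ex_derive.
Qed.

(* Tonelli, after writing [1 / y ^ 2] as the integral of [t exp (- t y)]. *)
Lemma integraly_1Bcos_div (r : R) : 0 < r ->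
  (\int[mu]_(y in `[0%R, +oo[) ((1 - cos (r * y)) / y ^+ 2)%:E =
   (r * (pi / 2))%:E)%E.
Proof.
move=> r0.
pose g (y t : R) := (1 - cos (r * y)) * (t * expR (- (t * y))).
(* The range of [t] is open at [0] because the Laplace transform of [1 - cos (r y)] is available
   only for [t > 0]; the endpoint has measure zero. *)
pose f (z : R * R) : \bar R :=
  (\1_(`[0, +oo[%classic : set R) z.1 * (\1_(`]0, +oo[%classic : set R) z.2 * g z.1 z.2))%:E.
have mf : measurable_fun setT f.
  have mexp : measurable_fun setT (fun z : R * R => expR (- (z.2 * z.1))).
    apply: measurableT_comp => //; apply: measurableT_comp => //.
    by apply: measurable_funM; [exact: measurable_snd|exact: measurable_fst].
  have mcos : measurable_fun setT (fun z : R * R => 1 - cos (r * z.1)).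
    apply: measurable_funB => //; apply: measurableT_comp.
      by apply: continuous_measurable_fun; exact: continuous_cos.
    by apply: measurable_funM; [exact: measurable_cst|exact: measurable_fst].
  have m1 (D : set R) : measurable D -> measurable_fun setT (fun z : R * R => \1_D z.1 : R).
    by move=> mD; apply: measurableT_comp => //; exact: measurable_indic.
  have m2 (D : set R) : measurable D -> measurable_fun setT (fun z : R * R => \1_D z.2 : R).
    by move=> mD; apply: measurableT_comp => //; exact: measurable_indic.
  apply/measurable_EFinP; apply: measurable_funM; first exact: m1.
  apply: measurable_funM; first exact: m2.
  apply: measurable_funM => //.
  by apply: measurable_funM => //; exact: measurable_snd.
have f0 z : (0 <= f z)%E.
  rewrite lee_fin mulr_ge0// !indicE mem_setE in_itv/= andbT; case: ltP => z0.
    by rewrite mul1r !mulr_ge0 ?expR_ge0 ?(ltW z0)// subr_ge0 cos_le1.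
  by rewrite mul0r.
have := @fubini_tonelli _ _ _ _ _ mu mu f mf f0.
have -> : (\int[mu]_y \int[mu]_t f (y, t) =
    \int[mu]_(y in `[0%R, +oo[) ((1 - cos (r * y)) / y ^+ 2)%:E)%E.
  rewrite -integral_indicM; apply: eq_integral => y _; rewrite /f /=.
  rewrite indicE mem_setE in_itv/= andbT; case: ltP => [y0|y0].
    by under eq_integral do rewrite mul0r; rewrite integral0 mul0r.
  under eq_integral do rewrite mul1r.
  (* At [y = 0] both sides vanish: the quotient is [0 / 0], which is [0] by convention, and the
     numerator kills the integrand. *)
  rewrite integral_indicM mul1r; move: y0; rewrite le_eqVlt => /predU1P[<-|y0].
    rewrite mulr0 cos0 subrr mul0r.
    by under eq_integral do rewrite /g mulr0 cos0 subrr mul0r; rewrite integral0.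
  under eq_integral do rewrite /g EFinM.
  rewrite ge0_integralZl_EFin//; last 2 first.
  - by move=> t; rewrite /= in_itv/= andbT => t0; rewrite lee_fin mulr_ge0 ?expR_ge0// ltW.
  - by apply/measurable_EFinP; apply: measurable_funTS; exact: measurable_Mexp.
  rewrite integral_itv_obnd_cbnd ?integraly_Mexpn//.
  by apply/measurable_EFinP; apply: measurable_funTS; exact: measurable_Mexp.
move=> ->.
(* In the other order the factor [t] cancels the [t] in the denominator of the Laplace transform. *)
have -> : (\int[mu]_t \int[mu]_y f (y, t) =
    \int[mu]_(t in `]0%R, +oo[) (r ^+ 2 / (t ^+ 2 + r ^+ 2))%:E)%E.
  rewrite -integral_indicM; apply: eq_integral => t _; rewrite /f /=.
  under eq_integral do rewrite mulrCA.
  rewrite indicE mem_setE in_itv/= andbT; case: ltP => [t0|t0]; last first.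
    by under eq_integral do rewrite mul0r; rewrite integral0 mul0r.
  under eq_integral do rewrite mul1r.
  rewrite integral_indicM mul1r.
  under eq_integral do rewrite /g mulrCA EFinM.
  rewrite ge0_integralZl_EFin//; last 2 first.
  - apply/measurable_EFinP; apply: measurable_funTS.
    apply: continuous_measurable_fun => y; apply: derivable1_continuous.
    exact: ex_derive.
  - exact: ltW.
  rewrite integraly_1Bcos_expR// -EFinM; congr EFin; field.
  by rewrite (gt_eqF t0) gt_eqF// addr_gt0 ?exprn_gt0.
rewrite integral_itv_obnd_cbnd ?integraly_lorentz//.
apply/measurable_EFinP; apply: measurable_funTS.
apply: continuous_measurable_fun => t; apply: derivable1_continuous.
have tr0 : t ^+ 2 + r ^+ 2 != 0 by rewrite gt_eqF// ltr_wpDl ?exprn_gt0// sqr_ge0.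
exact: ex_derive.
Qed.

(** The multiplier of Fejer summation. For [r > 0] the truncation at [0] makes it continuous on the
    whole line with support [[- r, r]]. *)
Definition tri (r w : R) : R := Num.max 0 (1 - `|w| / r).

Lemma tri_ge0 (r w : R) : 0 <= tri r w.
Proof. by rewrite le_max lexx. Qed.

Lemma tri_le1 (r w : R) : 0 < r -> tri r w <= 1.
Proof. by move=> r0; rewrite ge_max ler01 gerBl divr_ge0// ltW. Qed.

Lemma tri_out (r w : R) : 0 < r -> w \notin `[- r, r] -> tri r w = 0.
Proof.
move=> r0; rewrite in_itv/= -ler_norml -ltNge => rw.
by apply/max_idPl; rewrite subr_le0 ler_pdivlMr// mul1r ltW.
Qed.

Lemma tri_in (r w : R) : 0 < r -> 0 <= w <= r -> tri r w = 1 - w / r.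
Proof.
move=> r0 /andP[w0 wr]; rewrite /tri ger0_norm//; apply/max_idPr.
by rewrite subr_ge0 ler_pdivrMr// mul1r.
Qed.

Lemma triN (r w : R) : tri r (- w) = tri r w.
Proof. by rewrite /tri normrN. Qed.

Lemma continuous_tri (r : R) : continuous (tri r).
Proof.
move=> w; apply: (@continuous_max R R (cst 0) (fun w => 1 - `|w| / r)).
  exact: cvg_cst.
apply: cvgB; first exact: cvg_cst.
by apply: cvgM; [exact: norm_continuous|exact: cvg_cst].
Qed.

Lemma tri_le_indic (r w : R) : 0 < r -> tri r w <= \1_(`[- r, r]%classic : set R) w.
Proof.
move=> r0; rewrite indicE mem_setE; have [wr|wr] := boolP (w \in `[- r, r]).
  exact: tri_le1.
by rewrite tri_out.
Qed.

Lemma integrable_triM (r : R) (f : R -> R) : 0 < r -> measurable_fun setT f ->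
  (forall w, `|f w| <= 1) ->
  mu.-integrable setT (EFin \o (fun w => tri r w * f w)).
Proof.
move=> r0 mf f1.
apply: (@le_integrable_real _ (\1_(`[- r, r]%classic : set R))).
- apply: measurable_funM => //; apply: continuous_measurable_fun.
  exact: continuous_tri.
- move=> w; rewrite normrM (ger0_norm (tri_ge0 _ _)) (le_trans _ (tri_le_indic _ w r0))//.
  by rewrite ler_piMr ?tri_ge0.
- exact: integrable_indic_itv.
Qed.

(* This is [2 pi] times the normalised Fejer kernel. *)
Definition fejer (r y : R) : R := \int[mu]_w (tri r w * cos (w * y)).

Lemma continuous_cosM (y : R) : continuous (fun w : R => cos (w * y)).
Proof. by move=> w; apply: derivable1_continuous; exact: ex_derive. Qed.

Lemma measurable_cosM (y : R) : measurable_fun setT (fun w : R => cos (w * y)).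
Proof. by apply: continuous_measurable_fun; exact: continuous_cosM. Qed.

Lemma norm_cos_le1 (y : R) : `|cos y| <= 1.
Proof. by rewrite ler_norml cos_geN1 cos_le1. Qed.

Lemma norm_sin_le1 (y : R) : `|sin y| <= 1.
Proof. by rewrite ler_norml sin_geN1 sin_le1. Qed.

Lemma integrable_tri_cos (r y : R) : 0 < r ->
  mu.-integrable setT (EFin \o (fun w => tri r w * cos (w * y))).
Proof.
move=> r0; apply: (integrable_triM _ _ r0 (measurable_cosM y)) => w.
exact: norm_cos_le1.
Qed.

(** The integrand is even and supported in [[- r, r]], so the integral is twice that over [[0, r]].
    At [y = 0] the right side would be [0] by the division convention. *)
Lemma fejerE (r y : R) : 0 < r -> y != 0 ->
  fejer r y = 2 * ((1 - cos (r * y)) / (r * y ^+ 2)).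
Proof.
move=> r0 y0; rewrite /fejer.
pose f w := tri r w * cos (w * y).
have cf : continuous f.
  by move=> w; apply: cvgM; [exact: continuous_tri|exact: continuous_cosM].
have intf : mu.-integrable setT (EFin \o f).
  exact: integrable_tri_cos.
have -> : \int[mu]_w f w = \int[mu]_(w in `[- r, r]) f w.
  rewrite [RHS]Rintegral_mkcond; apply: eq_Rintegral => w _.
  rewrite patchE mem_setE; case: ifPn => // wr.
  by rewrite /f tri_out// mul0r.
have half : \int[mu]_(w in `[0, r]) f w = (1 - cos (r * y)) / (r * y ^+ 2).
  rewrite -integral_triangle_cos//; apply: eq_Rintegral => w.
  by rewrite inE/= in_itv/= /f => w0r; rewrite tri_in.
have intS a b : mu.-integrable [set` Interval a b] (EFin \o f).
  exact: integrableS intf.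
(* The integral is split at [0]; the substitution of [- w] for [w] then turns the left half into the
   right one. *)
have := @Rintegral_itvB R f (BLeft (- r)) (BRight r) 0 (intS _ _).
rewrite !bnd_simp oppr_le0 (ltW r0) => /(_ isT isT).
rewrite Rintegral_itv_obnd_cbnd// half => /eqP; rewrite subr_eq => /eqP ->.
rewrite mulr_natl mulr2n; congr +%R; rewrite -half /Rintegral; congr fine.
rewrite -[in LHS]oppr0 integration_by_substitution_oppr//; last 2 first.
- exact: ltW.
- exact: continuous_subspaceT.
by apply: eq_integral => w _; rewrite /= /f triN mulNr cosN.
Qed.

Lemma fejer0_ge0 (r : R) : 0 <= fejer r 0.
Proof.
by apply: Rintegral_ge0 => w _; rewrite mulr0 cos0 mulr1 tri_ge0.
Qed.

Lemma fejer_ge0 (r y : R) : 0 < r -> 0 <= fejer r y.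
Proof.
move=> r0; have [->|y0] := eqVneq y 0; first exact: fejer0_ge0.
by rewrite fejerE// mulr_ge0// divr_ge0 ?subr_ge0 ?cos_le1// mulr_ge0 ?sqr_ge0 ?ltW.
Qed.

Lemma fejer_le (r y : R) : 0 < r -> y != 0 -> fejer r y <= 4 / r / y ^+ 2.
Proof.
move=> r0 y0; rewrite fejerE// -mulrA -invfM mulrA ler_pM2r; last first.
  by rewrite invr_gt0 mulr_gt0// exprn_even_gt0.
have := cos_geN1 (r * y); lra.
Qed.

Lemma fejerN (r y : R) : fejer r (- y) = fejer r y.
Proof. by apply: eq_Rintegral => w _; rewrite mulrN cosN. Qed.

(** Dominated convergence, with the triangle as a majorant that does not depend on [y]. *)
Lemma continuous_fejer (r : R) : 0 < r -> continuous (fejer r).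
Proof.
move=> r0 y.
apply: (@continuity_under_integral R _ _ mu (fun y w => tri r w * cos (w * y))
  setT measurableT (y - 1) (y + 1) _ _ (fun w => tri r w * 1)).
- by move=> x _; exact: integrable_tri_cos.
- apply: aeW => w _ x _; apply: cvgM; first exact: cvg_cst.
  under eq_fun do rewrite mulrC.
  by rewrite (mulrC w); exact: continuous_cosM.
- by apply: integrable_triM => // w; rewrite normr1.
- move=> x _; apply: aeW => w _; rewrite normrM (ger0_norm (tri_ge0 _ _)).
  by rewrite ler_wpM2l ?tri_ge0// norm_cos_le1.
- by rewrite inE/= in_itv/= ltrDl ltr01 gtrBl ltr01.
Qed.

(** By evenness the integral is twice that over the positive half-line, and
    [2 (2 / r) (r pi / 2) = 2 pi]. *)
Lemma integral_fejer (r : R) : 0 < r ->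
  (\int[mu]_y (fejer r y)%:E = (2 * pi)%:E)%E.
Proof.
move=> r0; rewrite ge0_symfun_integralT; last 3 first.
- by move=> y; exact: fejer_ge0.
- exact: continuous_fejer.
- by move=> y; rewrite /= fejerN.
pose q (y : R) := (1 - cos (r * y)) / y ^+ 2.
have fejerq y : y \in (`]0, +oo[%classic : set R) -> fejer r y = 2 / r * q y.
  rewrite inE/= in_itv/= andbT => y0.
  by rewrite fejerE ?gt_eqF// /q; field; rewrite !gt_eqF.
have mfejer : measurable_fun setT (fejer r).
  by apply: continuous_measurable_fun; exact: continuous_fejer.
(* Measurability of the quotient is inherited from the continuous [fejer r], a constant multiple of
   it on this half-line. *)
have mq : measurable_fun (`]0, +oo[%classic : set R) q.
  apply: (eq_measurable_fun (fun y => r / 2 * fejer r y)).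
    by move=> y y0; rewrite fejerq//; field; rewrite gt_eqF.
  by apply: measurable_funTS; exact: measurable_funM.
rewrite -set_itvcy -integral_itv_obnd_cbnd; last first.
  by apply/measurable_EFinP; exact: measurable_funTS.
under eq_integral => y y0 do rewrite fejerq// EFinM.
rewrite ge0_integralZl_EFin//; last 3 first.
- by move=> y y0; rewrite lee_fin divr_ge0 ?sqr_ge0// subr_ge0 cos_le1.
- exact/measurable_EFinP.
- by rewrite divr_ge0// ltW.
rewrite integral_itv_obnd_cbnd; last exact/measurable_EFinP.
rewrite integraly_1Bcos_div// -!EFinM; congr EFin; field.
by rewrite gt_eqF.
Qed.

End Kernel.

(** * Approximation by convolution *)

Section Approximation.
Context {R : realType}.
Local Notation mu := (@lebesgue_measure R).

Lemma integral_fejer_shift (r x : R) : 0 < r ->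
  (\int[mu]_t (fejer r (t - x))%:E = (2 * pi)%:E)%E.
Proof.
move=> r0; rewrite -(integral_fejer _ r0).
have dF : derive1 (fun t : R => t - x) = cst 1.
  apply/funext => t; have dt : is_derive t 1 (fun t => t - x) 1.
    by apply: is_derive_eq; rewrite subr0.
  by rewrite derive1E (@derive_val _ _ _ _ _ _ _ dt).
rewrite (@increasing_ge0_integration_by_substitutionT R (fun t => t - x) (fejer r)).
- by apply: eq_integral => t _; rewrite dF /= !fctE mulr1.
- by move=> s t st; rewrite ltrD2r.
- by rewrite dF; exact: cst_continuous.
- by rewrite dF; exact: is_cvg_cst.
- by rewrite dF; exact: is_cvg_cst.
- by move=> t; exact: ex_derive.
- apply/cvgrNyPle => A; near=> t; rewrite lerBlDr.
  by near: t; apply: nbhs_ninfty_le; rewrite num_real.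
- apply/cvgryPge => A; near=> t; rewrite lerBrDr.
  by near: t; apply: nbhs_pinfty_ge; rewrite num_real.
- exact: continuous_fejer.
- by move=> t; exact: fejer_ge0.
Unshelve. all: by end_near. Qed.

Lemma continuous_invX2_shift (x t : R) : t != x ->
  {for t, continuous (fun t => (t - x) ^- 2)}.
Proof.
move=> tx; apply: derivable1_continuous.
have tx0 : (t - x) ^+ 2 != 0 by rewrite expf_neq0// subr_eq0.
exact: ex_derive.
Qed.

Lemma integraly_invX2_shift (x d : R) : 0 < d ->
  (\int[mu]_(t in `[(d + x)%R, +oo[) ((t - x) ^- 2)%:E = (d^-1)%:E)%E.
Proof.
move=> d0.
have tx0 t : d + x <= t -> t - x != 0.
  by move=> dxt; rewrite gt_eqF// subr_gt0 (lt_le_trans _ dxt)// ltrDr.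
have dF t : d + x <= t -> is_derive t 1 (fun t => - (t - x)^-1) ((t - x) ^- 2).
  move=> dxt; have t0 := tx0 _ dxt.
  apply: is_derive_eq; rewrite /GRing.scale /=; field.
  by rewrite t0.
rewrite (integraly_is_derive _ _ _ 0 _ _ dF).
- by rewrite sub0r opprK addrK.
- by move=> t _; rewrite invr_ge0 sqr_ge0.
- by move=> t dxt; apply: continuous_invX2_shift; rewrite -subr_eq0 tx0.
- rewrite -oppr0; apply: cvgN; apply/cvgrPdist_le => e e0; near=> t.
  rewrite sub0r normrN.
  have xt : x + e^-1 < t by near: t; apply: nbhs_pinfty_gt; rewrite num_real.
  have t0 : 0 < t - x.
    by rewrite subr_gt0 (lt_trans _ xt)// ltrDl invr_gt0.
  rewrite gtr0_norm ?invr_gt0// -[leRHS]invrK lef_pV2 ?posrE ?invr_gt0//.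
  by rewrite lerBrDl ltW.
Unshelve. all: by end_near. Qed.

Lemma integralNy_invX2_shift (x d : R) : 0 < d ->
  (\int[mu]_(t in `]-oo, (x - d)%R]) ((t - x) ^- 2)%:E = (d^-1)%:E)%E.
Proof.
move=> d0; rewrite -(opprB d x) ge0_integration_by_substitutionNy.
- rewrite -(integraly_invX2_shift (- x) _ d0).
  by apply: eq_integral => t _; rewrite /= opprK -opprD sqrrN.
- apply: continuous_in_subspaceT => t; rewrite inE/= in_itv/= opprB => txd.
  by apply: continuous_invX2_shift; rewrite lt_eqF// (le_lt_trans txd)// gtrBl.
- by move=> t _; rewrite invr_ge0 sqr_ge0.
Qed.

(** For [d > 0], an integrable majorant for the decay of the kernel: [(t - x)^-2] cut off to
    distance at least [d] from [x]. The two half-lines stay separate because each is integrated by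
    its own formula. *)
Definition tail (x d t : R) : R :=
  \1_(`[d + x, +oo[%classic : set R) t * (t - x) ^- 2 +
  \1_(`]-oo, x - d]%classic : set R) t * (t - x) ^- 2.

Lemma tail_ge0 (x d t : R) : 0 <= tail x d t.
Proof. by rewrite addr_ge0// mulr_ge0// invr_ge0 sqr_ge0. Qed.

Lemma invX2_le_tail (x d t : R) : d <= `|t - x| -> (t - x) ^- 2 <= tail x d t.
Proof.
have t0 : 0 <= (t - x) ^- 2 by rewrite invr_ge0 sqr_ge0.
rewrite ler_normr => /orP[|] dt; rewrite /tail.
  by rewrite indicE mem_setE in_itv/= andbT -lerBrDr dt mul1r lerDl mulr_ge0.
rewrite [X in _ + X * _]indicE mem_setE in_itv/=.
have -> : t <= x - d by lra.
by rewrite mul1r lerDr mulr_ge0.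
Qed.

(** On [D] the function is continuous since the singularity [x] lies outside, and extension by zero
    keeps it measurable. *)
Lemma measurable_tail_part (x : R) (D : set R) : measurable D ->
  (forall t, D t -> t != x) ->
  measurable_fun setT (fun t => \1_D t * (t - x) ^- 2).
Proof.
move=> mD Dx.
rewrite (_ : (fun _ => _) = (fun t => (t - x) ^- 2) \_ D); last first.
  apply/funext => t; rewrite patchE indicE.
  by case: ifP => _; rewrite ?mul1r ?mul0r.
apply/(measurable_restrictT _ mD).
apply: subspace_continuous_measurable_fun => //.
apply: continuous_in_subspaceT => t; rewrite inE => Dt.
exact: continuous_invX2_shift (Dx _ Dt).
Qed.

Lemma measurable_tail_right (x d : R) : 0 < d -> measurable_fun setT
  (fun t => \1_(`[d + x, +oo[%classic : set R) t * (t - x) ^- 2).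
Proof.
move=> d0; apply: measurable_tail_part => // t /=; rewrite in_itv/= andbT => dt.
by rewrite gt_eqF// (lt_le_trans _ dt)// ltrDr.
Qed.

Lemma measurable_tail_left (x d : R) : 0 < d -> measurable_fun setT
  (fun t => \1_(`]-oo, x - d]%classic : set R) t * (t - x) ^- 2).
Proof.
move=> d0; apply: measurable_tail_part => // t /=; rewrite in_itv/= => dt.
by rewrite lt_eqF// (le_lt_trans dt)// gtrBl.
Qed.

Lemma integral_tail (x d : R) : 0 < d ->
  (\int[mu]_t (tail x d t)%:E = (2 / d)%:E)%E.
Proof.
move=> d0; rewrite /tail; under eq_integral do rewrite EFinD.
have ge0 (D : set R) t : (0 <= (\1_D t * (t - x) ^- 2)%:E)%E.
  by rewrite lee_fin mulr_ge0// invr_ge0 sqr_ge0.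
rewrite ge0_integralD//; last 2 first.
- by apply/measurable_EFinP; exact: measurable_tail_right.
- by apply/measurable_EFinP; exact: measurable_tail_left.
rewrite !integral_indicM integraly_invX2_shift// integralNy_invX2_shift//.
by rewrite -EFinD mulr_natl mulr2n.
Qed.

Lemma measurable_tail (x d : R) : 0 < d -> measurable_fun setT (tail x d).
Proof.
by move=> d0; apply: measurable_funD; [exact: measurable_tail_right|exact: measurable_tail_left].
Qed.

Lemma ge0_integrable_of_eq (f : R -> R) (c : R) : measurable_fun setT f ->
  (forall x, 0 <= f x) -> (\int[mu]_x (f x)%:E = c%:E)%E ->
  mu.-integrable setT (EFin \o f).
Proof.
move=> mf f0 fc; apply/integrableP; split; first exact/measurable_EFinP.
under eq_integral do rewrite /= ger0_norm//.
by rewrite fc ltry.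
Qed.

(** The kernel has mass [2 pi], so the difference is the integral of [P t - P x] against it. The two
    error terms come from [|t - x| <= d] and from its complement. *)
Lemma fejer_approx (P : R -> R) (M L r x d : R) : 0 < r -> 0 < d -> 0 <= L ->
  measurable_fun setT P -> (forall t, `|P t| <= M) ->
  (forall t, `|P t - P x| <= L * `|t - x|) ->
  `|\int[mu]_t (P t * fejer r (t - x)) - 2 * pi * P x| <=
  2 * pi * (L * d) + 16 * M / (r * d).
Proof.
move=> r0 d0 L0 mP PM PL; pose k t := fejer r (t - x).
have M0 : 0 <= M by rewrite (le_trans _ (PM 0)).
have k0 t : 0 <= k t by exact: fejer_ge0.
have mk : measurable_fun setT k.
  apply: measurableT_comp; last exact: measurable_funB.
  by apply: continuous_measurable_fun; exact: continuous_fejer.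
have ik : mu.-integrable setT (EFin \o k).
  exact: ge0_integrable_of_eq (integral_fejer_shift _ _ r0).
have it : mu.-integrable setT (EFin \o tail x d).
  apply: ge0_integrable_of_eq (integral_tail x _ d0); last exact: tail_ge0.
  exact: measurable_tail.
have Ik : \int[mu]_t k t = 2 * pi by rewrite /Rintegral integral_fejer_shift.
have It : \int[mu]_t tail x d t = 2 / d by rewrite /Rintegral integral_tail.
have icM (c : R) (f : R -> R) : mu.-integrable setT (EFin \o f) ->
    mu.-integrable setT (EFin \o (fun t => c * f t)).
  by move=> fi; exact: (integrableZl _ c fi).
have iPk : mu.-integrable setT (EFin \o (fun t => P t * k t)).
  apply: (@le_integrable_real _ _ (fun t => M * k t)); last exact: icM.
    exact: measurable_funM.
  by move=> t; rewrite normrM (ger0_norm (k0 t)) ler_wpM2r.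
have -> : \int[mu]_t (P t * k t) - 2 * pi * P x =
    \int[mu]_t (P t * k t - P x * k t).
  by rewrite RintegralB//; [rewrite RintegralZl// Ik mulrC|exact: icM].
have iB : mu.-integrable setT (EFin \o (fun t => P t * k t - P x * k t)).
  exact: (integrableB _ iPk (icM (P x) _ ik)).
apply: (le_trans (le_normr_Rintegral _ iB)) => //.
have -> : 2 * pi * (L * d) + 16 * M / (r * d) =
    \int[mu]_t (L * d * k t + 8 * M / r * tail x d t).
  rewrite RintegralD//; [|exact: icM|exact: icM].
  rewrite !RintegralZl// Ik It; field.
  by rewrite !gt_eqF.
apply: le_Rintegral => //.
- exact: integrable_norm.
- exact: (integrableD _ (icM _ _ ik) (icM _ _ it)).
move=> t _; rewrite -mulrBl normrM (ger0_norm (k0 t)).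
(* Near [x] the Lipschitz bound gives the first summand. Farther away, [|P t - P x| <= 2 M] times
   the kernel bound [4 / (r (t - x)^2)] gives the second. *)
have [td|dt] := leP `|t - x| d.
  rewrite (@le_trans _ _ (L * d * k t))//.
    by rewrite ler_wpM2r// (le_trans (PL t))// ler_wpM2l.
  by rewrite lerDl mulr_ge0 ?tail_ge0// divr_ge0 ?mulr_ge0// ltW.
have tx : t - x != 0 by rewrite -normr_gt0 (lt_trans d0 dt).
rewrite (@le_trans _ _ (8 * M / r * tail x d t))//; last first.
  by rewrite lerDr !mulr_ge0// ltW.
rewrite (@le_trans _ _ (2 * M * (4 / r / (t - x) ^+ 2)))//.
  apply: ler_pM => //; last exact: fejer_le.
  by rewrite (le_trans (ler_normB _ _))// mulr_natl mulr2n lerD.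
rewrite (_ : _ * _ = 8 * M / r * (t - x) ^- 2); last first.
  by field; rewrite tx gt_eqF.
by rewrite ler_wpM2l ?invX2_le_tail ?(ltW dt)// divr_ge0 ?mulr_ge0// ltW.
Qed.

End Approximation.

(** * The Fourier side *)

Section FourierInversion.
Context {R : realType}.
Local Notation mu := (@lebesgue_measure R).

Lemma EFin_Rintegral (f : R -> R) : mu.-integrable setT (EFin \o f) ->
  ((\int[mu]_x f x)%:E = \int[mu]_x (f x)%:E)%E.
Proof. by move=> fi; rewrite /Rintegral fineK//; exact: integrable_fin_num. Qed.

Lemma integrableMbnd (P f : R -> R) : mu.-integrable setT (EFin \o P) ->
  measurable_fun setT f -> (forall t, `|f t| <= 1) ->
  mu.-integrable setT (EFin \o (fun t => P t * f t)).
Proof.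
move=> iP mf f1; apply: (@le_integrable_real _ _ (fun t => `|P t|)).
- by apply: measurable_funM => //; apply/measurable_EFinP; exact: measurable_int iP.
- by move=> t; rewrite normrM ler_piMr.
- exact: integrable_norm.
Qed.

(** With the factor [1 / sqrt (2 pi)], [costr] and [sintr] become the real part and minus the
    imaginary part of the Fourier transform of an integrable [P]. *)
Definition costr (P : R -> R) (w : R) : R := \int[mu]_t (P t * cos (w * t)).
Definition sintr (P : R -> R) (w : R) : R := \int[mu]_t (P t * sin (w * t)).

Lemma measurable_Mcos (w : R) : measurable_fun setT (fun t : R => cos (w * t)).
Proof.
apply: continuous_measurable_fun => t; apply: derivable1_continuous.
exact: ex_derive.
Qed.

Lemma measurable_Msin (w : R) : measurable_fun setT (fun t : R => sin (w * t)).
Proof.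
apply: continuous_measurable_fun => t; apply: derivable1_continuous.
exact: ex_derive.
Qed.

Variable P : R -> R.
Hypothesis iP : mu.-integrable setT (EFin \o P).

Let mP : measurable_fun setT P.
Proof. by apply/measurable_EFinP; exact: measurable_int iP. Qed.

Lemma integrableMcos (w : R) :
  mu.-integrable setT (EFin \o (fun t => P t * cos (w * t))).
Proof.
by apply: integrableMbnd => // [|t]; [exact: measurable_Mcos|exact: norm_cos_le1].
Qed.

Lemma integrableMsin (w : R) :
  mu.-integrable setT (EFin \o (fun t => P t * sin (w * t))).
Proof.
by apply: integrableMbnd => // [|t]; [exact: measurable_Msin|exact: norm_sin_le1].
Qed.

Lemma continuous_costr : continuous (costr P).
Proof.
move=> w.
apply: (@continuity_under_integral R _ _ mu (fun w t => P t * cos (w * t))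
  setT measurableT (w - 1) (w + 1) _ _ (fun t => `|P t|)).
- by move=> x _; exact: integrableMcos.
- apply: aeW => t _ x _; apply: cvgM; first exact: cvg_cst.
  exact: continuous_cosM.
- exact: integrable_norm.
- by move=> x _; apply: aeW => t _; rewrite normrM ler_piMr// norm_cos_le1.
- by rewrite inE/= in_itv/= ltrDl ltr01 gtrBl ltr01.
Qed.

Lemma norm_costr_le (w : R) : `|costr P w| <= \int[mu]_t `|P t|.
Proof.
apply: (le_trans (le_normr_Rintegral _ (integrableMcos w))) => //.
apply: le_Rintegral => //.
- exact: (integrable_norm (integrableMcos w)).
- exact: integrable_norm.
- by move=> t _; rewrite normrM ler_piMr// norm_cos_le1.
Qed.

(** The majorant is the triangle times the [L^1] norm of [P]. A general [h] covers both the cosine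
    multiples of [costr P] and its positive and negative parts. *)
Lemma integrable_tri_costr (r : R) (h : R -> R) : 0 < r ->
  measurable_fun setT h -> (forall w, `|h w| <= `|costr P w|) ->
  mu.-integrable setT (EFin \o (fun w => tri r w * h w)).
Proof.
move=> r0 mh hc.
apply: (@le_integrable_real _ _ (fun w => (\int[mu]_t `|P t|) * (tri r w * 1))).
- apply: measurable_funM => //; apply: continuous_measurable_fun.
  exact: continuous_tri.
- move=> w; rewrite normrM (ger0_norm (tri_ge0 _ _)) mulr1 mulrC.
  by rewrite ler_wpM2r ?tri_ge0// (le_trans (hc w))// norm_costr_le.
- apply: (@integrableZl _ _ _ mu setT measurableT _ (EFin \o (fun w => tri r w * 1))).
  by apply: integrable_triM => // w; rewrite normr1.
Qed.

(** Inserting the integral that defines the kernel and exchanging the order shows that convolution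
    with it multiplies the transform by the triangle. *)
Lemma fejer_fubini (r x : R) : 0 < r -> (forall w, sintr P w = 0) ->
  \int[mu]_t (P t * fejer r (t - x)) =
  \int[mu]_w (tri r w * (cos (w * x) * costr P w)).
Proof.
move=> r0 S0.
pose f (z : R * R) := (tri r z.1 * (P z.2 * cos (z.1 * (z.2 - x))))%:E.
have mtri : measurable_fun setT (tri r).
  by apply: continuous_measurable_fun; exact: continuous_tri.
have mf : measurable_fun setT f.
  have mcos : measurable_fun setT (fun z : R * R => cos (z.1 * (z.2 - x))).
    apply: measurableT_comp.
      by apply: continuous_measurable_fun; exact: continuous_cos.
    apply: measurable_funM; first exact: measurable_fst.
    by apply: measurable_funB; [exact: measurable_snd|exact: measurable_cst].
  have mtri1 : measurable_fun setT (fun z : R * R => tri r z.1).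
    by apply: (measurableT_comp mtri); exact: measurable_fst.
  have mP2 : measurable_fun setT (fun z : R * R => P z.2).
    by apply: (measurableT_comp mP); exact: measurable_snd.
  by apply/measurable_EFinP; apply: measurable_funM => //; exact: measurable_funM.
have if_ : (mu \x mu)%E.-integrable setT f.
  (* Integrating [|f|] first in [t] leaves at most the [L^1] norm of [P] times the triangle, which
     is integrable in [w]. *)
  apply/integrable12ltyP => //.
  pose N := \int[mu]_t `|P t|.
  have iN : mu.-integrable setT (EFin \o (fun w => N * (tri r w * 1))).
    apply: (@integrableZl _ _ _ mu setT measurableT _ (EFin \o (fun w => tri r w * 1))).
    by apply: integrable_triM => // w; rewrite normr1.
  apply: (@le_lt_trans _ _ (\int[mu]_w (N * (tri r w * 1))%:E)%E); last first.
    by rewrite -EFin_Rintegral// ltry.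
  apply: ge0_le_integral => //.
  - by move=> w _; exact: integral_ge0.
  - have maf : measurable_fun setT (abse \o f) by exact: measurableT_comp.
    exact: (@measurable_fun_fubini_tonelli_F _ _ _ _ R mu (abse \o f) maf
      (fun z => abse_ge0 _)).
  - by apply/measurable_EFinP; move/measurable_int : iN => /measurable_EFinP.
  move=> w _; rewrite mulr1 mulrC EFinM EFin_Rintegral; last exact: integrable_norm.
  rewrite -ge0_integralZl_EFin//; last 2 first.
  - by apply/measurable_EFinP; exact: measurableT_comp.
  - exact: tri_ge0.
  apply: ge0_le_integral => //.
  - by apply: measurableT_comp => //; exact: measurable_fun_pair2.
  - by apply/measurable_EFinP; apply: measurable_funM => //; exact: measurableT_comp.
  - move=> t _; rewrite /f /= -EFinM lee_fin normrM (ger0_norm (tri_ge0 _ _)).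
    by rewrite ler_wpM2l ?tri_ge0// normrM ler_piMr// norm_cos_le1.
have := @Fubini _ _ _ _ _ mu mu f if_.
have -> : (\int[mu]_w \int[mu]_t f (w, t) =
    \int[mu]_w (tri r w * (cos (w * x) * costr P w))%:E)%E.
  apply: eq_integral => w _; rewrite /f /=.
  have iw : mu.-integrable setT (EFin \o (fun t => P t * cos (w * (t - x)))).
    apply: integrableMbnd => // [|t]; last exact: norm_cos_le1.
    apply: continuous_measurable_fun => t; apply: derivable1_continuous.
    exact: ex_derive.
  under eq_integral do rewrite EFinM.
  rewrite integralZl// -EFin_Rintegral// -EFinM; congr (_ * _)%:E.
  (* The cosine of a difference splits the integral into a cosine and a sine transform; the latter
     vanishes by [S0]. *)
  transitivity (\int[mu]_t (cos (w * x) * (P t * cos (w * t)) +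
      sin (w * x) * (P t * sin (w * t)))).
    by apply: eq_Rintegral => t _; rewrite mulrBr cosB; ring.
  rewrite RintegralD//; last 2 first.
  - exact: (integrableZl _ (cos (w * x)) (integrableMcos w)).
  - exact: (integrableZl _ (sin (w * x)) (integrableMsin w)).
  rewrite !RintegralZl//; [|exact: integrableMsin|exact: integrableMcos].
  by rewrite -/(sintr P w) S0 mulr0 addr0.
have -> : (\int[mu]_t \int[mu]_w f (w, t) =
    \int[mu]_t (P t * fejer r (t - x))%:E)%E.
  apply: eq_integral => t _; rewrite /f /=.
  under eq_integral do rewrite mulrCA EFinM.
  rewrite integralZl//; last exact: integrable_tri_cos.
  by rewrite -EFin_Rintegral//; exact: integrable_tri_cos.
by move=> E; rewrite /Rintegral -E.
Qed.

End FourierInversion.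

(** * Comparison with the sup norm *)

Section SupNorm.
Context {R : realType}.
Local Notation mu := (@lebesgue_measure R).

Lemma lipschitz_derive1 (P : R -> R) (L : R) : (forall x, derivable P x 1) ->
  (forall x, `|derive1 P x| <= L) -> forall s t, `|P t - P s| <= L * `|t - s|.
Proof.
move=> dP PL; suff H s t : s <= t -> `|P t - P s| <= L * `|t - s|.
  move=> s t; have [/H//|/ltW/H] := leP s t.
  by rewrite distrC [X in _ <= _ * X]distrC.
move=> st.
have [x _||c _ ->] := @MVT_segment R P (derive1 P) s t st.
- by rewrite derive1E; exact: derivableP.
- by apply: continuous_subspaceT => x; exact: derivable1_continuous.
- by rewrite normrM ler_wpM2r.
Qed.

Lemma le_supnorm (f : R -> R) (x : R) : (`|f x|%:E <= supnorm f)%E.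
Proof. by apply: ereal_sup_ubound; exists x. Qed.

Lemma supnorm_le (f : R -> R) (c : R) :
  (forall x, `|f x| <= c) -> (supnorm f <= c%:E)%E.
Proof. by move=> fc; apply: ge_ereal_sup => _ [x _ <-]; rewrite lee_fin. Qed.

Variable P : R -> R.
Hypothesis iP : mu.-integrable setT (EFin \o P).
Hypothesis S0 : forall w, sintr P w = 0.
Hypothesis P0 : P 0 = 0.

Let mP : measurable_fun setT P.
Proof. by apply/measurable_EFinP; exact: measurable_int iP. Qed.

Let s : R := Num.sqrt (2 * pi).
(** Under [S0] this is the Fourier transform of [P], as a real function. *)
Let p (w : R) : R := s^-1 * costr P w.

Let s0 : 0 < s.
Proof. by rewrite sqrtr_gt0 mulr_gt0// pi_gt0. Qed.

Let ss : s * s = 2 * pi.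
Proof. by rewrite -expr2 sqr_sqrtr// mulr_ge0// pi_ge0. Qed.

Let mp : measurable_fun setT p.
Proof.
apply: measurable_funM => //; apply: continuous_measurable_fun.
exact: continuous_costr.
Qed.

Let integrable_tri_le (r : R) (h : R -> R) : 0 < r -> measurable_fun setT h ->
  (forall w, `|h w| <= `|p w|) ->
  mu.-integrable setT (EFin \o (fun w => tri r w * h w)).
Proof.
move=> r0 mh hp.
have ih : mu.-integrable setT (EFin \o (fun w => tri r w * (s * h w))).
  apply: (integrable_tri_costr P iP) => // [|w]; first exact: measurable_funM.
  rewrite normrM gtr0_norm// -ler_pdivlMl// (le_trans (hp w))//.
  by rewrite normrM gtr0_norm ?invr_gt0.
apply: eq_integrable (integrableZl _ s^-1 ih) => // w _ /=.
by rewrite -EFinM; congr EFin; rewrite mulrCA mulKf// gt_eqF.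
Qed.

Lemma integrable_tri_pos (r : R) : 0 < r ->
  mu.-integrable setT (EFin \o (fun w => tri r w * p^\+ w)).
Proof.
move=> r0; apply: integrable_tri_le => //; first exact: measurable_funrpos.
move=> w; rewrite ger0_norm ?funrpos_ge0//.
have := congr1 (@^~ w) (funrposDneg p); rewrite /= => <-.
by rewrite lerDl funrneg_ge0.
Qed.

Lemma integrable_tri_neg (r : R) : 0 < r ->
  mu.-integrable setT (EFin \o (fun w => tri r w * p^\- w)).
Proof.
move=> r0; apply: integrable_tri_le => //; first exact: measurable_funrneg.
move=> w; rewrite ger0_norm ?funrneg_ge0//.
have := congr1 (@^~ w) (funrposDneg p); rewrite /= => <-.
by rewrite lerDr funrpos_ge0.
Qed.

(** The kernel approximation is used at [x], where it bounds [|P x|] through [A + B], and at [0],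
    where it makes [A] and [B] nearly equal. Each use costs [M / 4]. *)
Lemma norm_le_tri (r M L x : R) : 0 < M -> 0 <= L -> 0 < r ->
  512 * L / (pi * M) <= r ->
  (forall t, `|P t| <= M) -> (forall s t, `|P t - P s| <= L * `|t - s|) ->
  `|P x| <= 2 / s * (\int[mu]_w (tri r w * p^\+ w)) + M / 2 /\
  `|P x| <= 2 / s * (\int[mu]_w (tri r w * p^\- w)) + M / 2.
Proof.
move=> M0 L0 r0 rL PM PL; have pi0 := pi_gt0 R.
pose I y := \int[mu]_t (P t * fejer r (t - y)).
set A := \int[mu]_w (tri r w * p^\+ w); set B := \int[mu]_w (tri r w * p^\- w).
have ip := integrable_tri_pos _ r0; have im := integrable_tri_neg _ r0.
have sA : \int[mu]_w (s * (tri r w * p^\+ w)) = s * A by rewrite RintegralZl.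
have sB : \int[mu]_w (s * (tri r w * p^\- w)) = s * B by rewrite RintegralZl.
have isp : mu.-integrable setT (EFin \o (fun w => s * (tri r w * p^\+ w))).
  exact: (integrableZl _ s ip).
have ism : mu.-integrable setT (EFin \o (fun w => s * (tri r w * p^\- w))).
  exact: (integrableZl _ s im).
have I_approx y : `|I y - s * s * P y| <= s * s * (M / 4).
  (* The allowed error [s^2 M / 4 = pi M / 2] is shared equally. This distance makes the tail term
     exactly [pi M / 4], and the near term [128 L / r] is at most [pi M / 4] precisely when
     [r >= 512 L / (pi M)]. *)
  have d0 : 0 < 64 / (pi * r) by rewrite divr_gt0// mulr_gt0.
  have := fejer_approx P M L r y _ r0 d0 L0 mP PM (PL y).
  rewrite ss => /le_trans; apply.
  move: (pi : R) pi0 rL => q q0 rL.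
  have -> : 16 * M / (r * (64 / (q * r))) = q * M / 4.
    by field; rewrite !gt_eqF.
  have -> : 2 * q * (L * (64 / (q * r))) = 128 * L / r.
    by field; rewrite !gt_eqF.
  move: rL; rewrite ler_pdivrMr ?mulr_gt0// => rL.
  have : 128 * L / r <= q * M / 4 by rewrite ler_pdivrMr//; nra.
  by lra.
have costrE w : costr P w = s * p^\+ w - s * p^\- w.
  rewrite -mulrBr -[p^\+ w - _]/((p^\+ - p^\-) w) funrposBneg /p.
  by rewrite mulrA divff ?mul1r// gt_eqF.
have norm_costrE w : `|costr P w| = s * p^\+ w + s * p^\- w.
  rewrite -mulrDr -[p^\+ w + _]/((p^\+ + p^\-) w) funrposDneg /p /=.
  by rewrite normrM gtr0_norm ?invr_gt0// mulrA divff ?mul1r// gt_eqF.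
have IE y : I y = \int[mu]_w (tri r w * (cos (w * y) * costr P w)).
  exact: fejer_fubini.
(* At [0] the cosine is [1], so the signed integral of the transform appears. *)
have I0 : I 0 = s * A - s * B.
  rewrite IE -sA -sB -RintegralB//.
  apply: eq_Rintegral => w _; rewrite mulr0 cos0 costrE; ring.
have Ile y : `|I y| <= s * A + s * B.
  have ic : mu.-integrable setT
      (EFin \o (fun w => tri r w * (cos (w * y) * costr P w))).
    apply: (integrable_tri_costr P iP) => //.
      apply: measurable_funM; first exact: measurable_cosM.
      by apply: continuous_measurable_fun; exact: continuous_costr.
    by move=> w; rewrite normrM ler_piMl// norm_cos_le1.
  rewrite IE (le_trans (le_normr_Rintegral _ ic))//.
  rewrite -sA -sB -RintegralD//.
  apply: le_Rintegral => //.
  - exact: (integrable_norm ic).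
  - exact: (integrableD _ isp ism).
  move=> w _; rewrite normrM (ger0_norm (tri_ge0 _ _)).
  rewrite mulrCA [X in _ + X]mulrCA -mulrDr -norm_costrE.
  by rewrite ler_wpM2l ?tri_ge0// normrM ler_piMl// norm_cos_le1.
have hI := I_approx x; have hI0 := I_approx 0; have hIle := Ile x.
(* As [P 0 = 0], the approximation at [0] bounds [|A - B|]. *)
rewrite P0 mulr0 subr0 I0 in hI0.
have hP : s * s * `|P x| <= s * A + s * B + s * s * (M / 4).
  have -> : s * s * `|P x| = `|s * s * P x|.
    by rewrite normrM ger0_norm// mulr_ge0// ltW.
  have := ler_normB (I x) (I x - s * s * P x).
  rewrite opprB addrC subrK => Px; lra.
have /andP[hAB hBA] : - (s * s * (M / 4)) <= s * A - s * B <= s * s * (M / 4).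
  by rewrite -ler_norml.
have scale C : s * s * `|P x| <= 2 * s * C + s * s * (M / 2) ->
    `|P x| <= 2 / s * C + M / 2.
  move=> h; rewrite -(ler_pM2l s0) -(ler_pM2l s0) mulrA (le_trans h)//.
  rewrite le_eqVlt; apply/orP; left; apply/eqP; field.
  by rewrite gt_eqF.
by split; apply: scale; lra.
Qed.

End SupNorm.

(** * Passage to the complex Fourier transform and conclusion *)

Section FourierTransform.
Context {R : realType}.
Local Notation mu := (@lebesgue_measure R).
Implicit Types (P : R -> R) (w : R).

Lemma fourierRE P w : mu.-integrable setT (EFin \o P) -> fourierR P w =
  ((Num.sqrt (2 * pi))^-1 * costr P w +i* - ((Num.sqrt (2 * pi))^-1 * sintr P w))%C.
Proof.
move=> iP.
have -> : costr P w = \int[mu]_t (complex.Re ((P t)%:C * cexpi (- (w * t))))%C.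
  by apply: eq_Rintegral => t _; rewrite /= cosN mul0r subr0.
have -> : sintr P w = - \int[mu]_t (complex.Im ((P t)%:C * cexpi (- (w * t))))%C.
  rewrite -mulN1r -RintegralZl//.
    by apply: eq_Rintegral => t _; rewrite /= sinN mul0r addr0 mulN1r mulrN opprK.
  apply: eq_integrable (integrableZl _ (-1) (integrableMsin _ iP w)) => // t _.
  by rewrite /= sinN mul0r addr0 mulrN -EFinM mulN1r.
rewrite /fourierR /fourier /cintegral; apply/eqP; rewrite eq_complex /=.
by rewrite !mul0r subr0 addr0 mulrN opprK !eqxx.
Qed.

(** The triangle lies below the indicator of [[- r, r]], so dropping the weight only enlarges the
    integral of a nonnegative function. *)
Lemma tri_integral_le (r : R) (f : R -> R) : 0 < r ->
  measurable_fun setT f -> (forall w, 0 <= f w) ->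
  mu.-integrable setT (EFin \o (fun w => tri r w * f w)) ->
  ((\int[mu]_w (tri r w * f w))%:E <= \int[mu]_(w in `[(- r)%R, r]) (f w)%:E)%E.
Proof.
move=> r0 mf f0 fi; rewrite EFin_Rintegral// -(integral_indicM `[- r, r]%classic).
apply: ge0_le_integral => //.
- by move=> w _; rewrite lee_fin mulr_ge0// tri_ge0.
- exact: measurable_int fi.
- apply/measurable_EFinP; apply: measurable_funM; last exact: mf.
  by apply: measurable_indic; exact: measurable_itv.
- by move=> w _; rewrite lee_fin ler_wpM2r// tri_le_indic.
Qed.

End FourierTransform.

Theorem lemma1 (R : realType) (P : R -> R) (r : R)
    (bndP : [bounded P x | x in [set: R]])
    (drvP : forall x : R, derivable P x 1)
    (intP : lebesgue_measure.-integrable [set: R] (fun x => (P x)%:E))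
    (nzP : exists x : R, P x != 0)
    (realP : forall w : R, fourierR P w \is Num.real)
    (P0 : P 0 = 0)
    (hr : ((8 ^+ 3)%:E * supnorm (derive1 P) / (pi%:E * supnorm P) < r%:E)%E) :
  let Phat := fun w : R => complex.Re (fourierR P w) in
  (supnorm P <= (4 / Num.sqrt (2 * pi))%:E *
     \int[lebesgue_measure]_(w in `[(- r)%R, r]) ((Phat^\+)%R w)%:E)%E /\
  (supnorm P <= (4 / Num.sqrt (2 * pi))%:E *
     \int[lebesgue_measure]_(w in `[(- r)%R, r]) ((Phat^\-)%R w)%:E)%E.
Proof.
move=> Phat; have pi0 := pi_gt0 R.
have s0 : 0 < Num.sqrt (2 * pi) :> R by rewrite sqrtr_gt0 mulr_gt0.
(* A real transform has zero imaginary part, which is a nonzero multiple of the sine transform. *)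
have S0 w : sintr P w = 0.
  have := RIm_real (realP w); rewrite fourierRE// => -[] /eqP.
  by rewrite oppr_eq0 mulf_eq0 invr_eq0 gt_eqF//= => /eqP.
have PhatE : Phat = (fun w => (Num.sqrt (2 * pi))^-1 * costr P w).
  by apply/funext => w; rewrite /Phat fourierRE.
have [M ME M0] : exists2 M, supnorm P = M%:E & 0 < M.
  have [x Px] := nzP; have [N [_ /(_ (N + 1))]] := bndP.
  (* Boundedness supplies a bound for every real strictly above [N], hence [N + 1]. *)
  rewrite ltrDl ltr01 => /(_ isT) PN.
  have leN : (supnorm P <= (N + 1)%:E)%E by apply: supnorm_le => t; exact: PN.
  have := le_supnorm P x; move: leN; case: (supnorm P) => [M _|//|//].
  by rewrite lee_fin => PM; exists M => //; rewrite (lt_le_trans _ PM)// normr_gt0.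
have PM t : `|P t| <= M by rewrite -lee_fin -ME le_supnorm.
have pM0 : pi * M != 0 by rewrite mulf_neq0 ?gt_eqF.
(* If the sup norm of the derivative were [+oo], the quotient in [hr] would be [+oo] too, and no
   real [r] exceeds it. *)
have [L LE L0] : exists2 L, supnorm (derive1 P) = L%:E & 0 <= L.
  move: hr; rewrite ME -EFinM inver (negbTE pM0); have := le_supnorm (derive1 P) 0.
  case: (supnorm (derive1 P)) => [L + _|_|//].
    by rewrite lee_fin => PL; exists L => //; rewrite (le_trans _ PL).
  rewrite gt0_muley ?lte_fin ?exprn_gt0// gt0_mulye ?lte_fin ?invr_gt0 ?mulr_gt0//.
have rL : 512 * L / (pi * M) < r.
  move: hr; rewrite LE ME -!EFinM inver (negbTE pM0) -EFinM lte_fin.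
  by rewrite -natrX.
have r0 : 0 < r by rewrite (le_lt_trans _ rL)// !mulr_ge0 ?invr_ge0// ltW ?mulr_gt0.
have DL x : `|derive1 P x| <= L by rewrite -lee_fin -LE le_supnorm.
have PL := lipschitz_derive1 _ _ drvP DL.
have core x := norm_le_tri P intP S0 P0 r M L x M0 L0 r0 (ltW rL) PM PL.
have mc : measurable_fun setT Phat.
  rewrite PhatE; apply: measurable_funM => //; apply: continuous_measurable_fun.
  exact: continuous_costr.
(* Taking the supremum over [x] gives [M <= 2 A / sqrt (2 pi) + M / 2]; absorbing [M / 2] on the
   left doubles the constant to [4]. *)
have final A (I : \bar R) : (A%:E <= I)%E ->
    (forall x, `|P x| <= 2 / Num.sqrt (2 * pi) * A + M / 2) ->
    (supnorm P <= (4 / Num.sqrt (2 * pi))%:E * I)%E.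
  move=> AI Ax.
  have : (supnorm P <= (2 / Num.sqrt (2 * pi) * A + M / 2)%:E)%E.
    exact: supnorm_le.
  rewrite ME lee_fin => MA.
  apply: (@le_trans _ _ ((4 / Num.sqrt (2 * pi))%:E * A%:E)%E).
    by rewrite -EFinM lee_fin; lra.
  by rewrite lee_wpmul2l// lee_fin divr_ge0// ltW.
split; rewrite PhatE.
  apply: final (tri_integral_le _ _ r0 _ _ (integrable_tri_pos P intP _ r0)) _.
  - by rewrite -PhatE; exact: measurable_funrpos.
  - exact: funrpos_ge0.
  - by move=> x; have [] := core x.
apply: final (tri_integral_le _ _ r0 _ _ (integrable_tri_neg P intP _ r0)) _.
- by rewrite -PhatE; exact: measurable_funrneg.
- exact: funrneg_ge0.
- by move=> x; have [] := core x.
Qed.
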